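(* There is a choice $k=O(\log(1/\epsilon))$ such that the following randomized algorithm (the subspace restriction test) is a one-sided tester for odd-cycle-freeness with query complexity $O(1/\epsilon^{20})$. Given $\epsilon\in(0,1)$ and oracle access to $f:\mathbb{F}_2^n\to\{0,1\}$: pick $\alpha_1,\ldots,\alpha_k\in\mathbb{F}_2^n$ uniformly at random, let $H$ be the linear subspace spanned by $\alpha_1,\ldots,\alpha_k$, query $f$ on all of $H$, and accept if and only if the restriction of $f$ to $H$ is odd-cycle-free (there are no odd $m\ge1$ and $x_1,\ldots,x_m\in H$ with $f(x_i)=1$ for all $i$ and $x_1+\cdots+x_m=0$). That is, every odd-cycle-free $f$ is accepted with probability $1$, and every $f$ that is $\epsilon$-far from odd-cycle-free is rejected with probability at least $2/3$. *)

(* Defs.v *)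
From HB Require Import structures.
From mathcomp Require Export all_boot all_order all_algebra.
From mathcomp Require Export all_classical all_reals all_analysis.
Set Implicit Arguments.
Unset Strict Implicit.
Unset Printing Implicit Defensive.
Import Order.TTheory GRing.Theory Num.Theory.
Local Open Scope ring_scope.

Notation cube n := 'rV['F_2]_n.

Definition Pr_unif (R : realType) (T : finType) (E : T -> Prop) : R :=
  #|[set t : T | `[< E t >] ]%SET|%:R / #|T|%:R.

(* The points x i need not be distinct. *)
Definition odd_cycle_free_on (n : nat) (H : {vspace cube n})
    (f : cube n -> bool) : Prop :=
  ~ exists (m : nat) (x : 'I_m -> cube n),
      [/\ odd m, forall i, x i \in H, forall i, f (x i) = true
        & \sum_(i < m) x i = 0].

Definition odd_cycle_free (n : nat) (f : cube n -> bool) : Prop :=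
  odd_cycle_free_on fullv f.

Definition dist (R : realType) (n : nat) (f g : cube n -> bool) : R :=
  Pr_unif R (fun x : cube n => f x <> g x).

Definition far_from_odd_cycle_free (R : realType) (n : nat) (eps : R)
    (f : cube n -> bool) : Prop :=
  forall g : cube n -> bool, odd_cycle_free g -> eps <= dist R f g.

(* The coins of the subspace restriction test are the uniformly random
   k-tuples a; its queries are the points of <<a>>. *)
Definition srt_queries (n k : nat) (a : k.-tuple (cube n)) : {set cube n} :=
  [set x in <<a>>%VS]%SET.

Definition srt_accepts (n k : nat) (f : cube n -> bool)
    (a : k.-tuple (cube n)) : Prop :=
  odd_cycle_free_on <<a>>%VS f.

Definition srt_one_sided_tester (R : realType) (k : R -> nat) : Prop :=
  forall (eps : R) (n : nat) (f : cube n -> bool), 0 < eps < 1 ->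
    (odd_cycle_free f ->
       Pr_unif R (fun a : (k eps).-tuple (cube n) => srt_accepts f a) = 1) /\
    (far_from_odd_cycle_free eps f ->
       2 / 3 <= Pr_unif R
         (fun a : (k eps).-tuple (cube n) => ~ srt_accepts f a)).

(* u = O(v) with a constant uniform over the whole range (0, 1) of eps. *)
Definition bigO01 (R : realType) (u v : R -> R) : Prop :=
  exists2 C : R, 0 < C & forall eps : R, 0 < eps < 1 -> `|u eps| <= C * `|v eps|.

Definition srt_query_complexity_le (R : realType) (k : R -> nat)
    (q : R -> nat) : Prop :=
  forall (eps : R) (n : nat) (a : (k eps).-tuple (cube n)), 0 < eps < 1 ->
    (#|srt_queries a| <= q eps)%N.

(* Main.v *)
Require Import Defs.
From mathcomp Require Import all_boot all_order all_algebra.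
From mathcomp Require Import all_classical all_reals all_analysis.
From mathcomp Require Import ring lra zify.
Set Implicit Arguments.
Unset Strict Implicit.
Unset Printing Implicit Defensive.
Import Order.TTheory GRing.Theory Num.Theory.
Local Open Scope ring_scope.

(** A function f is odd-cycle-free iff some linear functional equals 1 wherever
    f does, so f is eps-far iff every functional vanishes on a set of density at
    least eps inside f^-1(1).  Split the random vectors into t rows V and two
    blocks W, W' of k rows.  For almost every x, some x + vV lies in f^-1(1) by
    Chebyshev's inequality, so that a functional witnessing acceptance is
    determined at x by its restriction b to the rows of V: call this value
    [label V b x].  Either [label V b] is far from linear, and then it fails to
    be additive at many pairs (x, x') by the Blum-Luby-Rubinfeld bound, or it is
    close to a linear functional and vanishes on much of f^-1(1).  In both cases
    the pairs (yW, yW'), which are pairwise independent, reveal a contradiction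
    except with probability O(2^-k / eps), which survives a union bound over
    the 2^t choices of b.  With 2^t of order eps^-2 and 2^k of order eps^-3 the
    number of queries is O(eps^-8). *)

(** * Averages over finite types and Chebyshev's inequality *)

Definition avg {R : realFieldType} {T : finType} (F : T -> R) : R :=
  (\sum_x F x) / #|T|%:R.

Section Averages.
Context {R : realFieldType}.
Implicit Types T U : finType.

Lemma eq_avg T (F G : T -> R) : (forall x, F x = G x) -> avg F = avg G.
Proof. by move=> FG; rewrite /avg; congr (_ / _); apply: eq_bigr. Qed.

Lemma ler_avg T (F G : T -> R) : (forall x, F x <= G x) -> avg F <= avg G.
Proof.
by move=> FG; rewrite /avg ler_wpM2r ?invr_ge0 ?ler0n//; apply: ler_sum.
Qed.

Lemma avgD T (F G : T -> R) : avg (fun x => F x + G x) = avg F + avg G.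
Proof. by rewrite /avg big_split mulrDl. Qed.

Lemma avgZ T (c : R) (F : T -> R) : avg (fun x => c * F x) = c * avg F.
Proof. by rewrite /avg -mulr_sumr mulrA. Qed.

Lemma avg_cst T (x0 : T) (c : R) : avg (fun _ : T => c) = c.
Proof.
have T0 : (0 < #|T|)%N by apply/card_gt0P; exists x0.
by rewrite /avg sumr_const -(mulr_natr c) mulfK// pnatr_eq0 -lt0n.
Qed.

Lemma avg_ge0 T (F : T -> R) : (forall x, 0 <= F x) -> 0 <= avg F.
Proof. by move=> F0; rewrite /avg mulr_ge0 ?invr_ge0 ?ler0n ?sumr_ge0. Qed.

Lemma avg_sum T (I : finType) (P : pred I) (F : I -> T -> R) :
  avg (fun x => \sum_(i | P i) F i x) = \sum_(i | P i) avg (F i).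
Proof. by rewrite /avg exchange_big/= mulr_suml. Qed.

Lemma avg_exchange T U (F : T -> U -> R) :
  avg (fun x => avg (fun y => F x y)) = avg (fun y => avg (fun x => F x y)).
Proof.
rewrite /avg -!mulr_suml exchange_big/= -!mulrA; congr (_ * _).
by rewrite mulrC.
Qed.

Lemma avg_pair T U (F : T * U -> R) :
  avg F = avg (fun x => avg (fun y => F (x, y))).
Proof.
rewrite /avg -!mulr_suml pair_big/= card_prod natrM invfM.
rewrite -mulrA [X in _ = _ * X]mulrC; congr (_ * _).
by apply: eq_bigr => -[].
Qed.

Lemma avg_inj T U (h : T -> U) (F : U -> R) :
  injective h -> #|T| = #|U| -> avg (fun x => F (h x)) = avg F.
Proof.
move=> hi TU; rewrite /avg TU; congr (_ / _).
have hb : bijective h by apply: inj_card_bij => //; rewrite TU.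
by rewrite [RHS](reindex h)//; apply: onW_bij.
Qed.

Lemma avg_shift (T : finZmodType) (a : T) (F : T -> R) :
  avg (fun x => F (x + a)) = avg F.
Proof. by apply: (avg_inj (h := fun x => x + a)) => //; apply: addIr. Qed.

(** If every event is missed, the count [S] is zero and so deviates from its mean [N * p] by all of
    it. Pairwise independence bounds the variance of [S] by [N * p], and Chebyshev's inequality
    concludes. *)
Lemma chebyshev_miss T (I : finType) (P : pred I) (E : I -> T -> bool) (p : R)
    (x0 : T) :
  0 < p ->
  (forall i, P i -> avg (fun t => (E i t)%:R) = p) ->
  (forall i j, P i -> P j -> i != j ->
     avg (fun t => (E i t && E j t)%:R) = p ^+ 2) ->
  avg (fun t => [forall (i | P i), ~~ E i t]%:R) * (#|P|%:R * p) <= 1.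
Proof.
move=> p0 E1 E2; set N : R := #|P|%:R.
pose S t : R := \sum_(i | P i) (E i t)%:R.
have [N0|Nn0] := eqVneq N 0; first by rewrite N0 mul0r mulr0.
have Np : 0 < N by rewrite lt_neqAle eq_sym Nn0 ler0n.
have ES : avg S = N * p.
  by rewrite avg_sum (eq_bigr (fun=> p))// sumr_const -mulr_natl.
have ES2 : avg (fun t => S t ^+ 2) <= N * p + (N * p) ^+ 2.
  have -> : avg (fun t => S t ^+ 2) =
      \sum_(i | P i) \sum_(j | P j) avg (fun t => (E i t && E j t)%:R).
    rewrite (eq_avg (G := fun t =>
      \sum_(i | P i) \sum_(j | P j) (E i t && E j t)%:R)).
      by rewrite avg_sum; apply: eq_bigr => i _; rewrite avg_sum.
    move=> t; rewrite expr2 /S mulr_suml; apply: eq_bigr => i _.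
    by rewrite mulr_sumr; apply: eq_bigr => j _; rewrite -natrM mulnb.
  have -> : N * p + (N * p) ^+ 2 = \sum_(i | P i) (p + N * p ^+ 2).
    by rewrite sumr_const -mulr_natl -/N; ring.
  apply: ler_sum => i Pi; rewrite (bigD1 i)//= lerD//.
    by rewrite -(E1 i Pi); apply: ler_avg => t; rewrite andbb.
  have -> : N * p ^+ 2 = \sum_(j | P j) p ^+ 2.
    by rewrite sumr_const -mulr_natl.
  rewrite [leRHS](bigD1 i)//= -[leLHS]add0r lerD ?sqr_ge0//.
  by apply: ler_sum => j /andP[Pj ji]; rewrite E2// eq_sym.
set m := avg _.
have : m * (N * p) ^+ 2 <= avg (fun t => (S t - N * p) ^+ 2).
  rewrite /m mulrC -avgZ; apply: ler_avg => t.
  case: forall_inP => [h|_]; last by rewrite mulr0 sqr_ge0.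
  rewrite mulr1 /S big1 ?sub0r ?sqrrN// => i Pi.
  by rewrite (negbTE (h i Pi)).
have -> : avg (fun t => (S t - N * p) ^+ 2) =
    avg (fun t => S t ^+ 2) - (N * p) ^+ 2.
  rewrite (eq_avg (G := fun t => S t ^+ 2 +
    ((- (2 * (N * p))) * S t + (N * p) ^+ 2))); last by move=> t; ring.
  by rewrite avgD avgD avgZ (avg_cst x0) ES; ring.
have Npp : 0 < N * p by rewrite mulr_gt0.
move=> h; rewrite -(ler_pM2r Npp) mul1r -mulrA -expr2.
by apply: le_trans h _; rewrite lerBlDr.
Qed.

Lemma union_bound T (I : finType) (E : I -> T -> bool) :
  avg (fun t => [exists i, E i t]%:R) <= \sum_i avg (fun t => (E i t)%:R) :> R.
Proof.
rewrite -avg_sum; apply: ler_avg => t.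
case: existsP => [[i Ei]|_]; last by apply: sumr_ge0 => i _; rewrite ler0n.
by rewrite (bigD1 i)//= Ei lerDl sumr_ge0// => j _; rewrite ler0n.
Qed.

End Averages.

(** * Random linear combinations over F_2 *)

Section RandomCombinations.
Context {R : realFieldType}.

(** With a right inverse [C] of [B], shifting [A] by [C *m Y] preserves the average and shifts
    [B *m A] by [Y]; averaging over [Y] makes the product uniform. *)
Lemma avg_mulmx_row_free {m k N : nat} (B : 'M['F_2]_(m, k))
    (F : 'M['F_2]_(m, N) -> R) :
  row_free B -> avg (fun A : 'M['F_2]_(k, N) => F (B *m A)) = avg F.
Proof.
move=> /row_freeP[C BC].
transitivity (avg (fun A : 'M['F_2]_(k, N) =>
    avg (fun Y : 'M['F_2]_(m, N) => F (B *m (A + C *m Y))))).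
  rewrite avg_exchange -[LHS](avg_cst (0 : 'M['F_2]_(m, N))).
  apply: eq_avg => Y.
  by rewrite (avg_shift (C *m Y) (fun A => F (B *m A))).
rewrite -[RHS](avg_cst (0 : 'M['F_2]_(k, N))); apply: eq_avg => A.
rewrite -[RHS](avg_shift (B *m A)); apply: eq_avg => Y.
by rewrite mulmxDr mulmxA BC mul1mx addrC.
Qed.

Lemma F2_cases (u : 'F_2) : (u == 0) || (u == 1).
Proof. by case: u => [] [|[|]]. Qed.

Lemma F2_neq0 (u : 'F_2) : (u != 0) = (u == 1).
Proof. by case: u => [] [|[|]]. Qed.

Lemma F2_addxx n (x : cube n) : x + x = 0.
Proof.
by apply/rowP => i; rewrite !mxE -mulr2n -mulr_natr pchar_Zp// mulr0.
Qed.

Lemma row_free_nz k (c : cube k) : c != 0 -> row_free c.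
Proof.
by move=> c0; rewrite /row_free rank_rV c0.
Qed.

Lemma row_free_pair k (c d : cube k) :
  c != 0 -> d != 0 -> c != d -> row_free (col_mx c d).
Proof.
move=> c0 d0 cd; apply: inj_row_free => v.
rewrite -[v]hsubmxK mul_row_col [lsubmx v]mx11_scalar [rsubmx v]mx11_scalar.
rewrite !mul_scalar_mx.
have /orP[/eqP->|/eqP->] := F2_cases (lsubmx v 0 0);
have /orP[/eqP->|/eqP->] := F2_cases (rsubmx v 0 0);
  rewrite ?scale0r ?scale1r ?add0r ?addr0.
- by rewrite raddf0 row_mx0.
- by move=> h; rewrite h eqxx in d0.
- by move=> h; rewrite h eqxx in c0.
- move=> /eqP; rewrite addr_eq0 => /eqP h.
  by move: cd; rewrite h -subr_eq0 -opprD F2_addxx oppr0 eqxx.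
Qed.

Lemma card_cube n : #|{: cube n}| = (2 ^ n)%N.
Proof. by rewrite card_mx card_Fp// mul1n. Qed.

(* Distinct nonzero combinations of the rows of a uniform matrix are pairwise
   independent, although not triple-wise. *)
Lemma miss_combinations {k N : nat} (E : cube N -> bool) (p : R) :
  0 < p -> p <= avg (fun x => (E x)%:R) ->
  avg (fun A : 'M['F_2]_(k, N) => [forall c : cube k, ~~ E (c *m A)]%:R) *
    ((2 ^ k - 1)%N%:R * p) <= 1.
Proof.
move=> p0 pE; set q : R := avg _ in pE.
have q0 : 0 < q by apply: lt_le_trans pE.
have := @chebyshev_miss R 'M['F_2]_(k, N) (cube k) [pred c | c != 0]
  (fun c A => E (c *m A)) q 0 q0.
have -> : #|[pred c : cube k | c != 0]| = (2 ^ k - 1)%N.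
  have := cardC1 (0 : cube k); rewrite card_cube subn1 => <-.
  by apply: eq_card => c; rewrite !inE.
(* Passing from the exact density [q] to [p <= q], and from nonzero [c] to all [c], can only
   decrease the left side. *)
move=> h; apply: (le_trans _ (h _ _)).
- apply: ler_pM.
  + by apply: avg_ge0 => A; rewrite ler0n.
  + by rewrite mulr_ge0 ?ler0n// ltW.
  + apply: ler_avg => A; rewrite ler_nat.
    case: forallP => [h'|_]//; case: forall_inP => //; case=> c _; exact: h'.
  + by rewrite ler_wpM2l ?ler0n.
- move=> c c0.
  exact: (avg_mulmx_row_free (fun x : cube N => (E x)%:R) (row_free_nz c0)).
- move=> c d c0 d0 cd.
  have <- : avg (fun Y : 'M['F_2]_(1 + 1, N) =>
      (E (usubmx Y) && E (dsubmx Y))%:R : R) = q ^+ 2.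
    rewrite (avg_inj (h := fun Y : 'M['F_2]_(1 + 1, N) => (usubmx Y, dsubmx Y))
      (fun xy : cube N * cube N => (E xy.1 && E xy.2)%:R)); first last.
    - by rewrite card_prod !card_mx -expnD mulnDl !mul1n.
    - by move=> Y Z [eu ed]; rewrite -[Y]vsubmxK eu ed vsubmxK.
    rewrite avg_pair expr2 -avgZ; apply: eq_avg => x.
    by rewrite mulrC -avgZ; apply: eq_avg => y /=; rewrite -mulnb natrM.
  rewrite -(avg_mulmx_row_free _ (row_free_pair c0 d0 cd)).
  by apply: eq_avg => A; rewrite mul_col_mx col_mxKu col_mxKd.
Qed.

End RandomCombinations.

(** * Characters, linearity testing and duality over F_2 *)

Section Linearity.
Context {R : realFieldType}.

Definition dot n (x : cube n) (a : 'cV['F_2]_n) : 'F_2 := (x *m a) 0 0.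

Lemma dotDl n (x y : cube n) (a : 'cV['F_2]_n) :
  dot (x + y) a = dot x a + dot y a.
Proof. by rewrite /dot mulmxDl mxE. Qed.

Lemma dot0l n (a : 'cV['F_2]_n) : dot 0 a = 0.
Proof. by rewrite /dot mul0mx mxE. Qed.

Lemma dotDr n (x : cube n) (a b : 'cV['F_2]_n) :
  dot x (a + b) = dot x a + dot x b.
Proof. by rewrite /dot mulmxDr mxE. Qed.

(** The nontrivial additive character of F_2. *)
Definition sgnF2 (u : 'F_2) : R := if u == 0 then 1 else -1.

Lemma sgnF2D u v : sgnF2 (u + v) = sgnF2 u * sgnF2 v.
Proof.
rewrite /sgnF2.
have /orP[/eqP->|/eqP->] := F2_cases u; have /orP[/eqP->|/eqP->] := F2_cases v;
  by rewrite /= ?mulr1 ?mul1r ?mulrNN ?mulr1.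
Qed.

Lemma sgnF2E u : sgnF2 u = 1 - 2 * (u != 0)%:R.
Proof. by rewrite /sgnF2; case: eqP => _ /=; ring. Qed.

(** Orthogonality of characters: for nonzero [x], translating [a] by a vector [d] with [dot x d = 1]
    negates the sum. *)
Lemma sum_sgn_dot n (x : cube n) :
  \sum_a sgnF2 (dot x a) = (x == 0)%:R * #|{: cube n}|%:R.
Proof.
have [->|x0] := eqVneq x 0.
  rewrite (eq_bigr (fun=> 1)); last first.
    by move=> a _; rewrite /dot mul0mx mxE /sgnF2 eqxx.
  by rewrite sumr_const mul1r !card_mx muln1 mul1n.
rewrite mul0r.
have /rV0Pn[i xi] := x0.
pose d : 'cV['F_2]_n := delta_mx i 0.
have xd : dot x d = 1.
  by apply/eqP; rewrite -F2_neq0 /dot -colE mxE.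
set S := \sum_a _.
have : S = - S.
  rewrite {1}/S (reindex_inj (addIr d))/= /S -sumrN; apply: eq_bigr => a _.
  by rewrite dotDr sgnF2D xd /sgnF2 /= mulrN1.
by move=> h; lra.
Qed.

Lemma F2_add_eq0 n (x y : cube n) : (x + y == 0) = (x == y).
Proof. by rewrite -(inj_eq (addIr y)) -addrA F2_addxx addr0 add0r. Qed.

(* Fourier proof of the Blum-Luby-Rubinfeld bound: the sum of the cubes of the
   Fourier coefficients is at most the largest one times the sum of squares. *)
Lemma blr n (g : cube n -> 'F_2) (d : R) :
  (forall a, d <= avg (fun x => (g x != dot x a)%:R)) ->
  d <= avg (fun x => avg (fun y => (g x + g y + g (x + y) != 0)%:R)).
Proof.
move=> hd; pose G : R := #|{: cube n}|%:R.
have G0 : 0 < G by rewrite /G ltr0n; apply/card_gt0P; exists 0.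
(* [S a / G] is the Fourier coefficient at [a] of the sign of [g]; it equals one minus twice the
   distance from [g] to the functional [a]. *)
pose S a := \sum_x sgnF2 (g x) * sgnF2 (dot x a).
have SM a : S a <= G * (1 - 2 * d).
  have -> : S a = G * (1 - 2 * avg (fun x => (g x != dot x a)%:R)).
    rewrite mulrBr mulr1 mulrCA [G * _]mulrC divfK ?lt0r_neq0//.
    rewrite /G -sum1_card natr_sum mulr_sumr -sumrB; apply: eq_bigr => x _.
    rewrite -sgnF2D sgnF2E; congr (_ - _ * (~~ _)%:R).
    have /orP[/eqP->|/eqP->] := F2_cases (g x);
    by have /orP[/eqP->|/eqP->] := F2_cases (dot x a).
  by rewrite ler_pM2l// lerB// ler_pM2l.
(* Parseval's identity. *)
have S2 : \sum_a S a ^+ 2 = G ^+ 2.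
  transitivity (\sum_x \sum_y \sum_a
      sgnF2 (g x) * sgnF2 (g y) * sgnF2 (dot (x + y) a)).
    under [RHS]eq_bigr do rewrite exchange_big.
    rewrite [RHS]exchange_big; apply: eq_bigr => a _.
    rewrite expr2 /S mulr_suml; apply: eq_bigr => x _.
    rewrite mulr_sumr; apply: eq_bigr => y _.
    by rewrite dotDl sgnF2D mulrACA.
  rewrite expr2 {1}/G -sum1_card natr_sum mulr_suml.
  apply: eq_bigr => x _; rewrite (bigD1 x)//= [X in _ + X]big1 => [|y yx].
    rewrite -mulr_sumr sum_sgn_dot F2_addxx eqxx addr0 -sgnF2D.
    have /orP[/eqP->|/eqP->] := F2_cases (g x);
      by rewrite /sgnF2 /= !mul1r.
  by rewrite -mulr_sumr sum_sgn_dot F2_add_eq0 eq_sym (negbTE yx) mul0r mulr0.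
(* By orthogonality only [z = x + y] survives in the triple sum, so the cubes measure the failures
   of additivity. *)
have S3 : \sum_a S a ^+ 3 =
    G * \sum_x \sum_y sgnF2 (g x + g y + g (x + y)).
  transitivity (\sum_x \sum_y \sum_z \sum_a
      sgnF2 (g x + g y + g z) * sgnF2 (dot (x + y + z) a)).
    under [RHS]eq_bigr do under eq_bigr do rewrite exchange_big.
    under [RHS]eq_bigr do rewrite exchange_big.
    rewrite [RHS]exchange_big; apply: eq_bigr => a _.
    rewrite 2!exprS expr1 /S mulr_suml; apply: eq_bigr => x _.
    rewrite mulr_suml mulr_sumr; apply: eq_bigr => y _.
    rewrite !mulr_sumr; apply: eq_bigr => z _.
    by rewrite !dotDl !sgnF2D; ring.
  rewrite mulr_sumr; apply: eq_bigr => x _.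
  rewrite mulr_sumr; apply: eq_bigr => y _.
  rewrite (bigD1 (x + y))//= [X in _ + X]big1 => [|z zxy].
    by rewrite -mulr_sumr sum_sgn_dot F2_addxx eqxx addr0 mul1r mulrC.
  by rewrite -mulr_sumr sum_sgn_dot F2_add_eq0 eq_sym (negbTE zxy) mul0r mulr0.
have : \sum_a S a ^+ 3 <= G * (1 - 2 * d) * G ^+ 2.
  rewrite -S2 mulr_sumr; apply: ler_sum => a _.
  by rewrite exprS ler_wpM2r ?sqr_ge0.
rewrite S3 -mulrA ler_pM2l//.
set B := avg _.
have -> : \sum_x \sum_y sgnF2 (g x + g y + g (x + y)) = (1 - 2 * B) * G ^+ 2.
  have -> : B = (\sum_x \sum_y (g x + g y + g (x + y) != 0)%:R) / G ^+ 2.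
    by rewrite /B /avg -mulr_suml -mulrA expr2 invfM.
  rewrite mulrBl mul1r -mulrA divfK ?expf_neq0 ?lt0r_neq0//.
  rewrite expr2 {1}/G -sum1_card natr_sum mulr_suml mulr_sumr -sumrB.
  apply: eq_bigr => x _.
  rewrite mul1r /G -sum1_card natr_sum mulr_sumr -sumrB; apply: eq_bigr => y _.
  by rewrite sgnF2E.
by rewrite ler_pM2r ?exprn_gt0// => h; lra.
Qed.

(* Duality: the all-ones vector is in the row space of the transposed matrix of
   points of S, or it is separated from it by the indicator of an odd cycle. *)
Lemma odd_cycle_free_dual k (S : pred (cube k)) :
  (forall m (x : 'I_m -> cube k),
     odd m -> (forall i, S (x i)) -> \sum_i x i != 0) ->
  exists b : 'cV['F_2]_k, forall c, S c -> dot c b = 1.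
Proof.
move=> ocf.
pose B : 'M['F_2]_(#|S|, k) := \matrix_(i < #|S|) enum_val i.
pose one : 'rV['F_2]_#|S| := const_mx 1.
have [/submxP[b hb]|] := boolP (one <= B^T)%MS.
  exists b^T => c Sc.
  have -> : c = row (enum_rank_in Sc c) B.
    by rewrite rowK enum_rankK_in.
  rewrite /dot -row_mul mxE -[B]trmxK -trmx_mul -hb mxE mxE.
  by [].
rewrite submxE => /rV0Pn[j].
(* As a cokernel column, [w] is a linear relation among the points of [S]; its coefficients do not
   sum to zero, so its support [A] is an odd cycle. *)
set w := col j (cokermx B^T).
have -> : (one *m cokermx B^T) 0 j = \sum_i w i 0.
  by rewrite mxE; apply: eq_bigr => i _; rewrite !mxE mul1r.
move=> w1.
have w0 : \sum_i w i 0 *: enum_val i = 0 :> cube k.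
  have : B^T *m w = 0 by rewrite /w colE mulmxA mulmx_coker mul0mx.
  move=> Bw; apply/rowP => l; have := congr1 (fun M : 'cV_k => M l 0) Bw.
  rewrite /= [in X in X -> _]mxE summxE [in X in X -> _]mxE => Bwl.
  rewrite [RHS]mxE; apply: etrans Bwl; apply: eq_bigr => i _.
  by rewrite [LHS]mxE mulrC; congr (_ * _); rewrite 2![RHS]mxE.
pose A := [pred i | w i 0 != 0].
(* The module is arbitrary, so that the identity serves both for the sum of the points and for the
   parity of [A]. *)
have wE (V : lmodType 'F_2) (F : 'I_#|S| -> V) :
    \sum_(i in A) F i = \sum_i w i 0 *: F i.
  rewrite [RHS](bigID (mem A))/= [X in _ = _ + X]big1 ?addr0 => [|i]; last first.
    by rewrite inE negbK => /eqP ->; rewrite scale0r.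
  by apply: eq_bigr => i; rewrite inE F2_neq0 => /eqP ->; rewrite scale1r.
have oA : odd #|A|.
  apply: contraNT w1 => ev.
  rewrite (eq_bigr (fun i => w i 0 *: (1 : ('F_2)^o))); last first.
    by move=> i _; rewrite /GRing.scale/= mulr1.
  rewrite -wE sumr_const -[#|A|]odd_double_half (negbTE ev) add0n -muln2.
  have two0 : 1 *+ 2 = 0 :> ('F_2)^o by apply/val_inj.
  by rewrite mulnC mulrnA two0 mul0rn.
have := ocf #|A| (fun i => enum_val (enum_val i : 'I_#|S|)) oA
  (fun i => enum_valP (enum_val i : 'I_#|S|)).
by rewrite -(big_enum_val (fun i : 'I_#|S| => enum_val i)) wE w0 eqxx.
Qed.
End Linearity.

(** * Analysis of the two-stage test *)

Section TwoStageTest.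
Context {R : realFieldType} {n : nat}.
Variable f : cube n -> bool.

Definition covered t (V : 'M['F_2]_(t, n)) (x : cube n) : bool :=
  [exists v : cube t, f (x + v *m V)].

(* If a linear functional equals 1 wherever f does and is given by b on the
   rows of V, then it is forced to equal [label V b] at every covered point. *)
Definition label t (V : 'M['F_2]_(t, n)) (b : 'cV['F_2]_t) (x : cube n) : 'F_2 :=
  if [pick v : cube t | f (x + v *m V)] is Some v then 1 + dot v b else 1.

(** The two contradictions with a functional extending [b]: a point of f^-1(1), itself covered
    through [v = 0], with forced value 0; or three forced values that are not additive. *)
Definition detects t (V : 'M['F_2]_(t, n)) (b : 'cV['F_2]_t) (x y : cube n) :=
  (f x && (label V b x == 0)) ||
  [&& covered V x, covered V y, covered V (x + y)
    & label V b x + label V b y + label V b (x + y) != 0].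

(** [Y] holds the blocks W and W' side by side, so that a single [y] yields the pair (yW, yW'). *)
Definition undetected t k (V : 'M['F_2]_(t, n)) (b : 'cV['F_2]_t)
    (Y : 'M['F_2]_(k, n + n)) : bool :=
  [forall y : cube k, ~~ detects V b (lsubmx (y *m Y)) (rsubmx (y *m Y))].

(** Every [v] that covers the point yields the same value [1 + dot v b], namely [dot y d], so the
    choice made by [pick] does not matter. *)
Lemma label_forced t k (V : 'M['F_2]_(t, n)) (W : 'M['F_2]_(k, n))
    (b : 'cV['F_2]_t) (d : 'cV['F_2]_k) (y : cube k) :
  (forall v z, f (v *m V + z *m W) -> dot v b + dot z d = 1) ->
  covered V (y *m W) -> label V b (y *m W) = dot y d.
Proof.
move=> h /existsP[v0 fv0]; rewrite /label; case: pickP => [v fv|/(_ v0)].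
  rewrite addrC in fv; apply/eqP; move/eqP: (h _ _ fv).
  by have /orP[/eqP->|/eqP->] := F2_cases (dot v b);
    have /orP[/eqP->|/eqP->] := F2_cases (dot y d).
by rewrite fv0.
Qed.

(** The labels at yW, yW' and yW + yW' are forced to be [dot y b2], [dot y b3] and
    [dot y (b2 + b3)]. They are additive because both blocks are combined by the same [y]. *)
Lemma functional_undetected t k (A : 'M['F_2]_(t + (k + k), n))
    (b : 'cV['F_2]_(t + (k + k))) :
  (forall c, f (c *m A) -> dot c b = 1) ->
  undetected (usubmx A) (usubmx b)
    (row_mx (usubmx (dsubmx A)) (dsubmx (dsubmx A))).
Proof.
set V := usubmx A; set W := usubmx (dsubmx A); set W' := dsubmx (dsubmx A).
set b1 := usubmx b; set b2 := usubmx (dsubmx b); set b3 := dsubmx (dsubmx b).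
move=> h.
have AE : A = col_mx V (col_mx W W') by rewrite !vsubmxK.
have bE : b = col_mx b1 (col_mx b2 b3) by rewrite !vsubmxK.
have h3 v z z' : f (v *m V + (z *m W + z' *m W')) ->
    dot v b1 + (dot z b2 + dot z' b3) = 1.
  move=> fv; have := h (row_mx v (row_mx z z')).
  rewrite AE bE /dot !mul_row_col => /(_ fv).
  by rewrite [X in X = 1 -> _]mxE [(z *m b2 + _) 0 0]mxE.
have lW y : covered V (y *m W) -> label V b1 (y *m W) = dot y b2.
  apply: label_forced => v z fv; have := h3 v z 0.
  by rewrite mul0mx dot0l !addr0 => /(_ fv).
have lW' y : covered V (y *m W') -> label V b1 (y *m W') = dot y b3.
  apply: label_forced => v z fv; have := h3 v 0 z.
  by rewrite mul0mx dot0l !add0r => /(_ fv).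
have lWW' y : covered V (y *m W + y *m W') ->
    label V b1 (y *m W + y *m W') = dot y (b2 + b3).
  rewrite -mulmxDr; apply: label_forced => v z fv.
  by rewrite dotDr; apply: h3; rewrite -mulmxDr.
apply/forallP => y; rewrite mul_mx_row row_mxKl row_mxKr.
rewrite /detects negb_or; apply/andP; split.
  apply/negP => /andP[fy].
  have cy : covered V (y *m W).
    by apply/existsP; exists 0; rewrite mul0mx addr0.
  rewrite lW//; have := h3 0 y 0; rewrite !mul0mx !dot0l !add0r !addr0.
  by move=> /(_ fy) ->.
apply/negP => /and4P[c1 c2 c3].
rewrite lW// lW'// lWW'// dotDr.
have /orP[/eqP->|/eqP->] := F2_cases (dot y b2);
by have /orP[/eqP->|/eqP->] := F2_cases (dot y b3).
Qed.

Lemma avg_row_mx (F : cube n -> cube n -> R) :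
  avg (fun z : cube (n + n) => F (lsubmx z) (rsubmx z)) =
  avg (fun x => avg (fun y => F x y)).
Proof.
rewrite (avg_inj (h := fun z : cube (n + n) => (lsubmx z, rsubmx z))
  (fun xy : cube n * cube n => F xy.1 xy.2)); first by rewrite avg_pair.
- by move=> z z' [el er]; rewrite -[z]hsubmxK el er hsubmxK.
- by rewrite card_prod !card_mx -expnD !mul1n.
Qed.

Variable eps : R.
Hypothesis eps_gt0 : 0 < eps.
Hypothesis f_far :
  forall a : 'cV['F_2]_n, eps <= avg (fun x => (f x && (dot x a == 0))%:R).

(** If the label vanishes on density [eps / 2] inside f^-1(1), the first kind of contradiction
    suffices. Otherwise [f_far] puts the label at distance at least [eps / 2] from every functional,
    and [blr] applies. *)
Lemma detects_density t (V : 'M['F_2]_(t, n)) (b : 'cV['F_2]_t) :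
  avg (fun x => (~~ covered V x)%:R) <= eps / 8 ->
  eps / 8 <= avg (fun z : cube (n + n) =>
    (detects V b (lsubmx z) (rsubmx z))%:R).
Proof.
set u := avg _ => hu.
rewrite (avg_row_mx (fun x y => (detects V b x y)%:R)).
set D := avg _.
pose p : R := avg (fun x => (f x && (label V b x == 0))%:R).
have pD : p <= D.
  apply: ler_avg => x; rewrite -[leLHS](avg_cst (0 : cube n)).
  by apply: ler_avg => y; rewrite /detects; case: (_ && _).
have e0 := eps_gt0.
have [hp|hp] := leP (eps / 2) p; first by lra.
have : eps / 2 <= avg (fun x => avg (fun y =>
    (label V b x + label V b y + label V b (x + y) != 0)%:R)).
  apply: blr => a.
  have : eps <= p + avg (fun x => (label V b x != dot x a)%:R).
    apply: le_trans (f_far a) _; rewrite -avgD; apply: ler_avg => x.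
    case: (f x) => //=; last by rewrite add0r ler0n.
    rewrite -natrD ler_nat.
    have /orP[/eqP->|/eqP->] := F2_cases (label V b x);
    by have /orP[/eqP->|/eqP->] := F2_cases (dot x a).
  by lra.
(* A failure of additivity is lost only if one of the uniform points [x], [y], [x + y] is uncovered,
   which costs at most three times [eps / 8]. *)
suff : avg (fun x => avg (fun y =>
    (label V b x + label V b y + label V b (x + y) != 0)%:R)) <= D + (u + (u + u)).
  by lra.
have u1 : u = avg (fun x => avg (fun y : cube n => (~~ covered V x)%:R)).
  by apply: eq_avg => x; rewrite (avg_cst (0 : cube n)).
have u2 : u = avg (fun x : cube n => avg (fun y => (~~ covered V y)%:R)).
  by rewrite (avg_cst (0 : cube n)).
have u3 : u = avg (fun x => avg (fun y => (~~ covered V (x + y))%:R)).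
  rewrite -[LHS](avg_cst (0 : cube n)); apply: eq_avg => x.
  by rewrite -[LHS](avg_shift x); apply: eq_avg => y; rewrite addrC.
rewrite {1}u1 {1}u2 u3 -!avgD; apply: ler_avg => x.
rewrite -!avgD; apply: ler_avg => y.
rewrite /detects -!natrD ler_nat.
by case: (_ && _); case: (covered V x); case: (covered V y);
  case: (covered V (x + y)); case: (_ != 0).
Qed.

(** For a fixed [x], the combinations of the rows of [V] must miss a translate of f^-1(1), whose
    density is at least [eps] by [f_far] at the zero functional. *)
Lemma uncovered_avg t :
  avg (fun V : 'M['F_2]_(t, n) => avg (fun x => (~~ covered V x)%:R)) *
    ((2 ^ t - 1)%N%:R * eps) <= 1.
Proof.
rewrite avg_exchange mulrC -avgZ -[leRHS](avg_cst (0 : cube n)).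
apply: ler_avg => x; rewrite mulrC.
under eq_avg do rewrite /covered negb_exists.
apply: (miss_combinations (E := fun v => f (x + v))) => //.
under eq_avg do rewrite addrC.
rewrite (avg_shift x (fun v => (f v)%:R)); apply: le_trans (f_far 0) _.
by apply: ler_avg => v; case: (f v); rewrite ?lern1 ?leq_b1//= ler_nat leq_b1.
Qed.

(** Markov's inequality in the form [1 <= 8 / eps * u] pays for the [V] leaving more than [eps / 8]
    uncovered; a union bound over the [2 ^ t] vectors [b] handles the others. *)
Lemma undetected_avg t k :
  (0 < t)%N -> (0 < k)%N ->
  avg (fun V : 'M['F_2]_(t, n) => avg (fun Y : 'M['F_2]_(k, n + n) =>
    [exists b, undetected V b Y]%:R)) <=
  8 / ((2 ^ t - 1)%N%:R * eps ^+ 2) + 8 * (2 ^ t)%:R / ((2 ^ k - 1)%N%:R * eps).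
Proof.
move=> t0 k0.
have T0 : 0 < (2 ^ t - 1)%N%:R :> R.
  by rewrite ltr0n subn_gt0 -(expn0 2) ltn_exp2l.
have K0 : 0 < (2 ^ k - 1)%N%:R :> R.
  by rewrite ltr0n subn_gt0 -(expn0 2) ltn_exp2l.
set c := 8 * _ / _.
have c0 : 0 <= c by rewrite divr_ge0 ?mulr_ge0 ?ler0n// ltW.
apply: (@le_trans _ _ (avg (fun V : 'M['F_2]_(t, n) =>
    8 / eps * avg (fun x => (~~ covered V x)%:R) + c))).
  apply: ler_avg => V; set u := avg (fun x => _).
  have u0 : 0 <= u by apply: avg_ge0 => x; rewrite ler0n.
  have [hu|hu] := leP u (eps / 8); last first.
    apply: (@le_trans _ _ 1).
      rewrite -[leRHS](avg_cst (0 : 'M['F_2]_(k, n + n))).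
      by apply: ler_avg => Y; rewrite lern1 leq_b1.
    rewrite -[leLHS]addr0 lerD// mulrAC ler_pdivlMr// mul1r.
    by move: hu; lra.
  apply: (@le_trans _ _ c); last by rewrite lerDr mulr_ge0// divr_ge0 ?ltW.
  apply: le_trans (union_bound _) _.
  have -> : c = \sum_(b : 'cV['F_2]_t) 8 / ((2 ^ k - 1)%N%:R * eps).
    rewrite sumr_const card_mx card_Fp// muln1 -mulr_natr /c; ring.
  apply: ler_sum => b _.
  rewrite ler_pdivlMr ?mulr_gt0//.
  have e8 : 0 < eps / 8 by rewrite divr_gt0.
  have := miss_combinations (k := k) e8 (detects_density b hu).
  by rewrite /undetected; set m := avg _; lra.
rewrite avgD avgZ (avg_cst (0 : 'M['F_2]_(t, n))) lerD2r.
have := uncovered_avg t.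
rewrite -ler_pdivlMr ?mulr_gt0// => h.
apply: (le_trans (ler_wpM2l _ h)); first by rewrite divr_ge0 ?ltW.
by rewrite le_eqVlt; apply/orP; left; apply/eqP; field; rewrite !lt0r_neq0.
Qed.

End TwoStageTest.

(** * From the two-stage test to the subspace restriction test *)

Section SubspaceRestrictionTest.
Context {R : realType}.

Lemma Pr_unif_avg (T : finType) (E : T -> Prop) :
  Pr_unif R E = avg (fun t => `[< E t >]%:R).
Proof.
rewrite /Pr_unif /avg; congr (_ / _).
rewrite -sum1_card natr_sum big_mkcond; apply: eq_bigr => t _.
by rewrite inE; case: ifP.
Qed.

(** Restricting f^-1(1) to the points where the functional is 1 leaves an odd-cycle-free function,
    since an odd number of ones does not sum to 0 in F_2. *)
Lemma far_avg n (eps : R) (f : cube n -> bool) (a : 'cV['F_2]_n) :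
  far_from_odd_cycle_free eps f ->
  eps <= avg (fun x => (f x && (dot x a == 0))%:R).
Proof.
move=> /(_ (fun x => f x && (dot x a != 0))) far.
apply: le_trans (far _) _.
  case=> m [x [om _ gx sx]].
  have := congr1 (fun y => dot y a) sx; rewrite dot0l.
  have -> : dot (\sum_i x i) a = \sum_i dot (x i) a.
    apply: (big_morph (fun y => dot y a)); last exact: dot0l.
    by move=> y z; rewrite dotDl.
  rewrite (eq_bigr (fun=> 1)) => [|i _]; last first.
    by have /andP[_] := gx i; rewrite F2_neq0 => /eqP.
  rewrite sumr_const card_ord -[m]odd_double_half om mulrnDr -muln2 mulnC.
  by rewrite mulrnA (_ : 1 *+ 2 = 0) ?mul0rn//; apply/val_inj.
rewrite /dist Pr_unif_avg; apply: ler_avg => x.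
rewrite ler_nat; case: asboolP => //.
by case: (f x) => //=; case: (_ == 0).
Qed.

Definition tuple_mx n k (a : k.-tuple (cube n)) : 'M['F_2]_(k, n) :=
  \matrix_(i < k) tnth a i.

Lemma tuple_mx_inj n k : injective (@tuple_mx n k).
Proof.
move=> a a' e; apply: eq_from_tnth => i.
by have := congr1 (row i) e; rewrite !rowK.
Qed.

Lemma mul_tuple_mx_span n k (a : k.-tuple (cube n)) (c : cube k) :
  c *m tuple_mx a \in <<a>>%VS.
Proof.
rewrite mulmx_sum_row; apply: memv_suml => i _; apply: memvZ.
by rewrite rowK; apply/memv_span/mem_tnth.
Qed.

(** Duality is applied to coefficient vectors rather than to points of the span, so the vectors of
    [a] may be dependent. *)
Lemma srt_accepts_functional n k (f : cube n -> bool) (a : k.-tuple (cube n)) :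
  srt_accepts f a ->
  exists b, forall c, f (c *m tuple_mx a) -> dot c b = 1.
Proof.
move=> acc.
apply: (@odd_cycle_free_dual k [pred c | f (c *m tuple_mx a)]) => m x om fx.
apply/negP => /eqP x0; apply: acc; exists m, (fun i => x i *m tuple_mx a).
split=> // [i|]; first exact: mul_tuple_mx_span.
by rewrite -mulmx_suml x0 mul0mx.
Qed.

Lemma srt_queries_card n k (a : k.-tuple (cube n)) :
  (#|srt_queries a| <= 2 ^ k)%N.
Proof.
rewrite -card_cube.
apply: leq_trans (leq_imset_card (fun c => c *m tuple_mx a) _).
apply/subset_leq_card/fintype.subsetP => x; rewrite inE => xa.
apply/imsetP; exists (\row_i coord a i x) => //.
rewrite {1}(coord_span xa) mulmx_sum_row; apply: eq_bigr => i _.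
by rewrite rowK mxE (tnth_nth 0).
Qed.

Lemma srt_accepts_ocf n k (f : cube n -> bool) (a : k.-tuple (cube n)) :
  odd_cycle_free f -> srt_accepts f a.
Proof.
move=> ocf [m [x [om _ fx sx]]]; apply: ocf; exists m, x.
by split=> // i; rewrite memvf.
Qed.

(** With [x = 2 ^+ s], at least [1 / eps], one has 2^t = 64 x^2 and 2^k = 4096 x^3, which makes each
    of the two error terms at most 1/6. *)
Lemma srt_rejects_far n (f : cube n -> bool) (eps : R) (s : nat) :
  let t := (2 * s + 6)%N in let k := (t + s + 6)%N in
  0 < eps < 1 -> 1 <= 2 ^+ s * eps -> far_from_odd_cycle_free eps f ->
  2 / 3 <= Pr_unif R
    (fun a : (t + (k + k)).-tuple (cube n) => ~ srt_accepts f a).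
Proof.
move=> t k /andP[e0 e1] se far; rewrite Pr_unif_avg.
have bound : avg (fun a : (t + (k + k)).-tuple (cube n) =>
    `[< srt_accepts f a >]%:R) <= 1 / 3 :> R.
  (* This rearrangement of the coins is a bijection, so [V] and [Y] are uniform and independent. *)
  pose h (a : (t + (k + k)).-tuple (cube n)) :
      'M['F_2]_(t, n) * 'M['F_2]_(k, n + n) :=
    let A := tuple_mx a in
    (usubmx A, row_mx (usubmx (dsubmx A)) (dsubmx (dsubmx A))).
  apply: (@le_trans _ _ (avg (fun a : (t + (k + k)).-tuple (cube n) =>
      [exists b, undetected f (h a).1 b (h a).2]%:R))).
    apply: ler_avg => a; rewrite ler_nat.
    case: asboolP => // /srt_accepts_functional[b hb].
    rewrite lt0b; apply/existsP; exists (usubmx b).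
    exact: functional_undetected hb.
  rewrite (avg_inj (h := h) (fun VY => [exists b, undetected f VY.1 b VY.2]%:R));
    first last.
  - rewrite card_tuple card_prod !card_mx -!expnM -expnD; congr (_ ^ _)%N.
    by rewrite mul1n mulnC mulnDl mulnDr mulnDl.
  - move=> a a' [eu /eq_row_mx[ed1 ed2]]; apply: tuple_mx_inj.
    rewrite -[tuple_mx a]vsubmxK -[dsubmx (tuple_mx a)]vsubmxK eu ed1 ed2.
    by rewrite !vsubmxK.
  rewrite avg_pair.
  have tpos : (0 < t)%N by rewrite /t addnS.
  have kpos : (0 < k)%N by rewrite /k addnS.
  apply: le_trans (undetected_avg e0 (fun a => far_avg a far) tpos kpos) _.
  have TE : (2 ^ t - 1)%N%:R = 64 * (2 ^+ s) ^+ 2 - 1 :> R.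
    rewrite natrB ?expn_gt0// natrX exprD mulnC exprM; ring.
  have T'E : (2 ^ t)%N%:R = 64 * (2 ^+ s) ^+ 2 :> R.
    rewrite natrX exprD mulnC exprM; ring.
  have KE : (2 ^ k - 1)%N%:R = 64 * (64 * (2 ^+ s) ^+ 2) * 2 ^+ s - 1 :> R.
    by rewrite natrB ?expn_gt0// /k (expnD _ (t + s)) (expnD _ t) !natrM T'E !natrX;
      ring.
  rewrite TE T'E KE.
  set x : R := 2 ^+ s in se *.
  have x1 : 1 <= x by rewrite exprn_ege1// ler1n.
  have xe2 : 1 <= x ^+ 2 * eps ^+ 2 by rewrite -exprMn exprn_ege1.
  have ee : eps ^+ 2 <= 1 by rewrite exprn_ile1// ltW.
  have xx : 1 <= x ^+ 2 by rewrite exprn_ege1.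
  have xxe : x ^+ 2 <= x ^+ 2 * (x * eps) by rewrite ler_peMr// sqr_ge0.
  have D1 : 48 <= (64 * x ^+ 2 - 1) * eps ^+ 2.
    by rewrite mulrBl mul1r -mulrA; lra.
  have D2 : 48 * (64 * x ^+ 2) <= (64 * (64 * x ^+ 2) * x - 1) * eps.
    have -> : (64 * (64 * x ^+ 2) * x - 1) * eps =
      4096 * (x ^+ 2 * (x * eps)) - eps by ring.
    by lra.
  have P1 : 8 / ((64 * x ^+ 2 - 1) * eps ^+ 2) <= 1 / 6.
    by rewrite ler_pdivrMr; lra.
  have P2 : 8 * (64 * x ^+ 2) / ((64 * (64 * x ^+ 2) * x - 1) * eps) <= 1 / 6.
    by rewrite ler_pdivrMr; lra.
  by lra.
rewrite (eq_avg (G := fun a => 1 + -1 * `[< srt_accepts f a >]%:R)).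
  rewrite avgD avgZ (avg_cst [tuple (0 : cube n) | _ < _]).
  by lra.
by move=> a; rewrite asbool_neg; case: asboolP => _ /=; ring.
Qed.

(* For eps > 1/2 no query is affordable, but then only the constant 1 on a
   point is far: a hyperplane of the cube has density 1/2. *)
Lemma far_half n (f : cube n -> bool) (eps : R) :
  1 / 2 < eps -> far_from_odd_cycle_free eps f -> f 0.
Proof.
move=> e2 far; case: n => [|n] in f far *.
  have := far_avg 0 far.
  apply: contraTT => f0; rewrite -ltNge.
  rewrite (eq_avg (G := fun=> 0)) ?(avg_cst (0 : cube 0)); first by lra.
  by move=> x; rewrite thinmx0 (negbTE f0).
pose a : 'cV['F_2]_n.+1 := delta_mx 0 0.
pose d : cube n.+1 := delta_mx 0 0.
have da : dot d a = 1 by rewrite /dot mul_delta_mx mxE.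
pose p : R := avg (fun x : cube n.+1 => (dot x a == 0)%:R).
have pq : p = avg (fun x : cube n.+1 => (dot x a != 0)%:R).
  rewrite /p -[LHS](avg_shift d); apply: eq_avg => x; rewrite dotDl da.
  by have /orP[/eqP->|/eqP->] := F2_cases (dot x a).
have p2 : p + p = 1.
  rewrite {2}pq -avgD -[RHS](avg_cst (0 : cube n.+1)); apply: eq_avg => x.
  by case: (_ == 0); rewrite /= ?addr0 ?add0r.
have pe : eps <= p.
  apply: le_trans (far_avg a far) _; apply: ler_avg => x.
  by case: (f x); rewrite //= ler0n.
by exfalso; lra.
Qed.

(** * Choice of the dimension *)

Definition srt_scale (eps : R) : nat := up_log 2 (Num.truncn (1 / eps)).+1.

(** The logarithm of [1 / eps] tends to 0 as [eps] approaches 1, which forces dimension 0 there; the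
    test then queries [f] at 0 only. *)
Definition srt_dim (eps : R) : nat :=
  if eps <= 1 / 2 then
    let s := srt_scale eps in let t := (2 * s + 6)%N in
    let k := (t + s + 6)%N in (t + (k + k))%N
  else 0%N.

Lemma srt_dimE (eps : R) : eps <= 1 / 2 -> srt_dim eps = (8 * srt_scale eps + 30)%N.
Proof. by rewrite /srt_dim => ->; set s := srt_scale eps; lia. Qed.

(** With [m] the integer part of [1 / eps] and [s] the scale, 2^(s-1) < m + 1 <= 2^s. The left
    inequality means 2^(s-1) <= m, hence the factor 2. *)
Lemma srt_scale_bounds (eps : R) : 0 < eps < 1 ->
  1 <= 2 ^+ srt_scale eps * eps <= 2.
Proof.
move=> /andP[e0 e1]; rewrite /srt_scale; set m := Num.truncn _.
have i0 : 0 <= 1 / eps by rewrite divr_ge0// ltW.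
have /andP[m1 m2] : m%:R <= 1 / eps < m.+1%:R by apply: truncn_itv.
have m0 : (0 < m)%N by rewrite truncn_gt_nat// ler_pdivlMr// mul1r ltW.
have /andP[l u] := @up_log_bounds 2 m.+1 isT m0.
have : (0 < up_log 2 m.+1)%N by rewrite up_log_gt0 /=.
case: (up_log 2 m.+1) l u => // s l u _.
rewrite -ler_pdivrMr// -[X in _ && X]ler_pdivlMr//; apply/andP; split.
  by apply: le_trans (ltW m2) _; rewrite -natrX ler_nat.
rewrite exprS -[2 / eps]mulr1 mulrAC -mulrA ler_pM2l//.
apply: le_trans m1.
by rewrite -natrX ler_nat -ltnS.
Qed.

End SubspaceRestrictionTest.

(** * The tester and its two complexity bounds *)

Unset Implicit Arguments.

Theorem theorem1p6 (R : realType) :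
  exists k : R -> nat,
    [/\ bigO01 (fun eps : R => (k eps)%:R) (fun eps : R => ln (1 / eps)),
        srt_one_sided_tester k
      & exists2 q : R -> nat,
          srt_query_complexity_le k q
          & bigO01 (fun eps : R => (q eps)%:R) (fun eps : R => 1 / eps ^+ 20)].
Proof.
exists srt_dim; split.
- have l2 : 0 < ln 2 :> R by rewrite ln_gt0 ?ltr1n.
  (* The dimension is [8 * s + 30], where [s * ln 2] is at most [ln 2 + ln (1 / eps)] and
     [ln 2 <= ln (1 / eps)]; 46 is 8 + 8 + 30. *)
  exists (46 / ln 2) => [|eps /[dup] e01 /andP[e0 e1]]; first by rewrite divr_gt0.
  rewrite normr_nat.
  have [he|he] := leP eps (1 / 2); last first.
    rewrite /srt_dim (lt_geF he) mulr_ge0// divr_ge0// ltW//.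
  have i2 : 2 <= 1 / eps by rewrite ler_pdivlMr//; lra.
  have l1 : ln 2 <= ln (1 / eps) by rewrite ler_ln ?posrE// divr_gt0.
  have /andP[_ se] := srt_scale_bounds e01.
  have : ln (2 ^+ srt_scale eps) <= ln (2 * (1 / eps)).
    have i0 : 0 < 1 / eps by rewrite divr_gt0.
    rewrite ler_ln ?posrE ?exprn_gt0 ?(mulr_gt0 _ i0)//.
    by rewrite mulrA mulr1 ler_pdivlMr.
  rewrite lnXn// lnM ?posrE ?divr_gt0// -(mulr_natr (ln 2)) => hs.
  rewrite ger0_norm ?(le_trans (ltW l2))// srt_dimE//.
  rewrite mulrAC ler_pdivlMr// natrD natrM.
  by lra.
- move=> eps n f e01; split=> [ocf|far].
    rewrite Pr_unif_avg -[RHS](avg_cst [tuple (0 : cube n) | _ < srt_dim eps]).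
    apply: eq_avg => a; case: asboolP => //.
    by have := srt_accepts_ocf ocf (a := a).
  have [he|he] := leP eps (1 / 2).
    rewrite /srt_dim he; apply: (srt_rejects_far e01 _ far).
    by case/andP: (srt_scale_bounds e01).
  have f0 := far_half he far.
  rewrite Pr_unif_avg.
  rewrite (eq_avg (G := fun=> 1)) ?(avg_cst [tuple (0 : cube n) | _ < _]).
    by lra.
  move=> a; case: asboolP => //; case => acc; apply: acc.
  (* The point 0 alone is an odd cycle of length one. *)
  exists 1%N, (fun=> 0); split=> // [i|]; first exact: mem0v.
  by rewrite big1.
- exists (fun eps => 2 ^ srt_dim eps)%N => [eps n a _|]; first exact: srt_queries_card.
  (* Here 2^(8s+30) eps^20 is (2^s eps)^8 times 2^30 eps^12, at most 2^8 times 2^30. *)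
  exists (2 ^+ 38) => [|eps /[dup] e01 /andP[e0 e1]]; first by rewrite exprn_gt0.
  rewrite normr_nat ger0_norm ?divr_ge0 ?exprn_ge0 ?(ltW e0)//.
  rewrite mulrA mulr1 ler_pdivlMr ?exprn_gt0//.
  have [he|he] := leP eps (1 / 2); last first.
    rewrite /srt_dim (lt_geF he) expn0 mul1r.
    apply: (@le_trans _ _ 1); first by rewrite exprn_ile1// ltW.
    by rewrite exprn_ege1// ler1n.
  have /andP[_ se] := srt_scale_bounds e01.
  rewrite srt_dimE// natrX exprD mulnC exprM -mulrA.
  have -> : eps ^+ 20 = eps ^+ 8 * eps ^+ 12 by rewrite -exprD.
  have -> : (2 ^+ 38 : R) = 2 ^+ 8 * 2 ^+ 30 by rewrite -exprD.
  rewrite [2 ^+ 30 * _]mulrC mulrA ler_pM2r ?exprn_gt0//.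
  rewrite mulrA -exprMn -[leRHS]mulr1.
  apply: ler_pM; rewrite ?exprn_ge0 ?mulr_ge0 ?(ltW e0)// ?exprn_ge0//.
  + by rewrite lerXn2r ?nnegrE ?mulr_ge0 ?exprn_ge0 ?(ltW e0).
  + by rewrite exprn_ile1// ltW.
Qed.
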